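(* Let $n\geq 1$ and $k\geq 2$ be integers, and let $r$ be an integer with $1\le r\le$ the number of length-$n$ unbordered words over $\Sigma_k$. The unbordered word $w\in\Sigma_k^n$ with rank $r$ (i.e., the $r$-th word in the lexicographic listing of all length-$n$ unbordered words over $\Sigma_k$) can be computed from $r,n,k$ in $O(n^4k\log k)$ time using $O(n)$ space, under the unit-cost RAM model.
   Context: $\Sigma_k=\{1,2,\ldots,k\}$ with $1<2<\cdots<k$, and $\Sigma_k^n$ is the set of length-$n$ words over $\Sigma_k$. Lexicographic order: for $x=x_1\cdots x_m$ and $y=y_1\cdots y_n$, $x<y$ if $x$ is a proper prefix of $y$, or if $x_i<y_i$ for the smallest $i$ with $x_i\neq y_i$. A border of a word $w$ is a word that is both a non-empty proper prefix and a non-empty proper suffix of $w$; $w$ is unbordered if it has no border. Ranks start at $1$. Unit-cost RAM model: integer variables use constant space and integer arithmetic operations take constant time. *)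

(* Defs.v *)
From mathcomp Require Import all_boot.
Set Implicit Arguments. Unset Strict Implicit. Unset Printing Implicit Defensive.

Definition words (n k : nat) : seq (seq nat) :=
  [seq [seq (nat_of_ord i).+1 | i <- val t] | t <- enum {: n.-tuple 'I_k}].

(* A border of w: a non-empty proper prefix u of w (necessarily u = take i w
   with 0 < i < size w) that is also a suffix of w. *)
Definition unbordered (w : seq nat) : bool :=
  [forall i : 'I_(size w), (0 < i) ==> ~~ (prefix (take i w) w && suffix (take i w) w)].

Fixpoint lexlt (x y : seq nat) : bool :=
  match x, y with
  | [::], [::] => false
  | [::], _ :: _ => true
  | _ :: _, [::] => false
  | a :: x', b :: y' => (a < b) || ((a == b) && lexlt x' y')
  end.

Definition unbordered_words (n k : nat) : seq (seq nat) :=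
  [seq w <- words n k | unbordered w].

(* w has rank r among length-n unbordered words (ranks start at 1). *)
Definition has_rank (n k r : nat) (w : seq nat) : Prop :=
  w \in unbordered_words n k /\
  count (fun u => lexlt u w) (unbordered_words n k) = r.-1.

(* Registers indexed by nat, each holding an unbounded natural number
   (constant space per register, each instruction costs one time unit). *)
Inductive instr : Type :=
| IConst (d v : nat)
| IAdd (d a b : nat)
| ISub (d a b : nat)          (* R[d] := R[a] - R[b] (truncated) *)
| IMul (d a b : nat)
| IDiv (d a b : nat)
| IMod (d a b : nat)
| ILoad (d a : nat)
| IStore (a s : nat)
| IJlt (a b l : nat)
| IJmp (l : nat)
| IHalt.

Definition program := seq instr.
Definition regs := nat -> nat.

Definition upd (R : regs) (d v : nat) : regs := fun j => if j == d then v else R j.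

(* One step of a non-halting instruction: new pc, new registers,
   and the list of register addresses accessed. *)
Definition step (i : instr) (pc : nat) (R : regs) : nat * regs * seq nat :=
  match i with
  | IConst d v => (pc.+1, upd R d v, [:: d])
  | IAdd d a b => (pc.+1, upd R d (R a + R b), [:: d; a; b])
  | ISub d a b => (pc.+1, upd R d (R a - R b), [:: d; a; b])
  | IMul d a b => (pc.+1, upd R d (R a * R b), [:: d; a; b])
  | IDiv d a b => (pc.+1, upd R d (R a %/ R b), [:: d; a; b])
  | IMod d a b => (pc.+1, upd R d (R a %% R b), [:: d; a; b])
  | ILoad d a => (pc.+1, upd R d (R (R a)), [:: d; a; R a])
  | IStore a s => (pc.+1, upd R (R a) (R s), [:: a; s; R a])
  | IJlt a b l => (if R a < R b then l else pc.+1, R, [:: a; b])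
  | IJmp l => (l, R, [::])
  | IHalt => (pc, R, [::])
  end.

(* run p fuel pc R = Some (R', acc) iff the program halts within [fuel]
   steps (executing IHalt, or reaching a pc outside the program, counts as
   a step), with final registers R' and accessed addresses acc. *)
Fixpoint run (p : program) (fuel pc : nat) (R : regs) : option (regs * seq nat) :=
  match fuel with
  | 0 => None
  | f.+1 =>
    match nth IHalt p pc with
    | IHalt => Some (R, [::])
    | i => let: (pc', R', acc) := step i pc R in
           match run p f pc' R' with
           | Some (R2, acc2) => Some (R2, acc ++ acc2)
           | None => None
           end
    end
  end.

Definition init_regs (r n k : nat) : regs :=
  fun j => if j == 0 then r else if j == 1 then n else if j == 2 then k else 0.

(* Space used = number of distinct registers accessed (inputs included). *)
Definition space_used (acc : seq nat) : nat := size (undup ([:: 0; 1; 2] ++ acc)).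

(* Main.v *)
Require Import Defs.
From mathcomp Require Import all_boot zify.

Set Implicit Arguments.
Unset Strict Implicit.
Unset Printing Implicit Defensive.

(** Fix a prefix [x] of length [m] and let [V l] be the number of unbordered
    words of length [l] that are prefix-comparable with [x].  A bordered word has
    exactly one unbordered border, and this border has length at most [l / 2].
    Hence [V l] is the number of words of length [l] comparable with [x] minus
    the sum over [1 <= i <= l / 2] of the number of those with an unbordered
    border of length [i].  The latter is [V i] times a product over the positions
    [i <= q < l] of the number of letters allowed at [q], which depends only on
    [x], [l] and [i].  This computes [V n] in [O(n^3)] steps from an array of size
    [n].  The word of rank [r] is then found letter by letter: for each position
    the letters are tried in increasing order, and [V n] is subtracted from the
    rank as long as it is smaller than the rank; at most [n * k] evaluations of
    [V n] occur.

    The RAM program is obtained by compiling structured commands, for which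
    termination, time, accessed addresses and postconditions are established
    together by a weakest-precondition calculus. *)

(** * Structured RAM commands *)

Inductive cmd : Type :=
| Blk (s : seq instr)
| Seq (c1 c2 : cmd)
| If (a b : nat) (c1 c2 : cmd)
| While (a b : nat) (c : cmd).

Fixpoint csize (c : cmd) : nat :=
  match c with
  | Blk s => size s
  | Seq c1 c2 => csize c1 + csize c2
  | If _ _ c1 c2 => (csize c2 + csize c1).+2
  | While _ _ c => (csize c).+2
  end.

Fixpoint compile (c : cmd) (pc : nat) : seq instr :=
  match c with
  | Blk s => s
  | Seq c1 c2 => compile c1 pc ++ compile c2 (pc + csize c1)
  | If a b c1 c2 =>
      IJlt a b (pc + (csize c2).+2) ::
      compile c2 pc.+1 ++
      IJmp (pc + csize (If a b c1 c2)) :: compile c1 (pc + (csize c2).+2)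
  | While a b c =>
      IJmp (pc + (csize c).+1) :: rcons (compile c pc.+1) (IJlt a b pc.+1)
  end.

Lemma size_compile c pc : size (compile c pc) = csize c.
Proof.
elim: c pc => [s|c1 IH1 c2 IH2|a b c1 IH1 c2 IH2|a b c IH] pc //=.
- by rewrite size_cat IH1 IH2.
- by rewrite size_cat /= IH1 IH2 addnS.
- by rewrite size_rcons IH.
Qed.

(** * Placement of code, and weakest preconditions with time and address bounds *)

Definition located (p : program) (pc : nat) (s : seq instr) : Prop :=
  forall j, j < size s -> nth IHalt p (pc + j) = nth IHalt s j.

Lemma located_cat p pc s1 s2 : located p pc (s1 ++ s2) ->
  located p pc s1 /\ located p (pc + size s1) s2.
Proof.
move=> H; split=> j hj.
  by rewrite H ?size_cat ?ltn_addr // nth_cat hj.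
by rewrite -addnA H ?size_cat ?ltn_add2l // nth_cat ltnNge leq_addr addKn.
Qed.

Lemma located_cons p pc i s : located p pc (i :: s) ->
  nth IHalt p pc = i /\ located p pc.+1 s.
Proof.
move=> H; split; first by rewrite -[pc]addn0 H.
by move=> j hj; rewrite addSnnS H.
Qed.

Definition emit (acc : seq nat) (o : option (regs * seq nat)) :=
  if o is Some (R, acc') then Some (R, acc ++ acc') else None.

Lemma emit_cat a1 a2 o : emit a1 (emit a2 o) = emit (a1 ++ a2) o.
Proof. by case: o => [[R a]|] //=; rewrite catA. Qed.

Definition non_halting (i : instr) : bool := if i is IHalt then false else true.

Definition sequential (i : instr) : bool :=
  match i with IJlt _ _ _ | IJmp _ | IHalt => false | _ => true end.

Lemma run_step p f pc R i : nth IHalt p pc = i -> non_halting i ->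
  run p f.+1 pc R =
    emit (step i pc R).2 (run p f (step i pc R).1.1 (step i pc R).1.2).
Proof. by move=> /= ->; case: i. Qed.

(** Quantifying over the leftover fuel [f] makes executions compose by rewriting: running [c]
    consumes exactly [t'] units and hands the rest to the code that follows. *)
Definition wp (S : nat) (c : cmd) (R : regs) (t : nat) (Q : regs -> Prop) :=
  forall p pc, located p pc (compile c pc) ->
  exists t' R' acc, [/\ t' <= t, all (gtn S) acc, Q R' &
    forall f, run p (t' + f) pc R = emit acc (run p f (pc + csize c) R')].

Lemma wp_conseq S c R t t' (Q Q' : regs -> Prop) :
  wp S c R t Q -> t <= t' -> (forall R', Q R' -> Q' R') -> wp S c R t' Q'.
Proof.
move=> H ht hQ p pc hl; have [u [R' [acc [h1 h2 h3 h4]]]] := H p pc hl.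
by exists u, R', acc; split=> //; [exact: leq_trans ht | exact: hQ].
Qed.

Fixpoint blk_run (s : seq instr) (R : regs) : regs :=
  if s is i :: s' then blk_run s' (step i 0 R).1.2 else R.

Fixpoint blk_in (S : nat) (s : seq instr) (R : regs) : bool :=
  if s is i :: s' then all (gtn S) (step i 0 R).2 && blk_in S s' (step i 0 R).1.2
  else true.

Lemma wp_blk S s R t (Q : regs -> Prop) :
  all sequential s -> size s <= t -> blk_in S s R -> Q (blk_run s R) ->
  wp S (Blk s) R t Q.
Proof.
move=> hs ht hb hQ p pc /= hl.
suff [acc h1 h2] : exists2 acc, all (gtn S) acc & forall f,
    run p (size s + f) pc R = emit acc (run p f (pc + size s) (blk_run s R)).
  by exists (size s), (blk_run s R), acc.
clear Q t ht hQ; elim: s pc R hs hb hl => [|i s IH] pc R.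
  by move=> *; exists [::] => // f; rewrite /= addn0 add0n; case: run => [[]|].
case/andP=> hi hs /andP[ha hb] /located_cons[hn hl].
have [acc h1 h2] := IH pc.+1 _ hs hb hl.
exists ((step i 0 R).2 ++ acc); first by rewrite all_cat ha.
move=> f; rewrite addSn (run_step _ _ hn) -?emit_cat; last by case: i hi {hn ha hb h1 h2}.
rewrite -addSnnS -h2.
by case: i hi {hn ha hb h1 h2}.
Qed.

Lemma wp_seq S c1 c2 R t1 t2 Q :
  wp S c1 R t1 (fun R1 => wp S c2 R1 t2 Q) -> wp S (Seq c1 c2) R (t1 + t2) Q.
Proof.
move=> H p pc /located_cat[hl1 hl2].
have [u1 [R1 [a1 [h1 h2 h3 h4]]]] := H p pc hl1.
rewrite size_compile in hl2.
have [u2 [R2 [a2 [g1 g2 g3 g4]]]] := h3 p _ hl2.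
exists (u1 + u2), R2, (a1 ++ a2); split=> //; first exact: leq_add.
  by rewrite all_cat h2.
by move=> f; rewrite -addnA h4 g4 emit_cat /= addnA.
Qed.

Lemma wp_if S a b c1 c2 R t Q : a < S -> b < S ->
  (R a < R b -> wp S c1 R t Q) -> (R b <= R a -> wp S c2 R t Q) ->
  wp S (If a b c1 c2) R t.+2 Q.
Proof.
move=> ha hb H1 H2 p pc /= /located_cons[hn /located_cat[hl2]].
rewrite size_compile => /located_cons[hj].
have -> : (pc.+1 + csize c2).+1 = pc + (csize c2).+2 by lia.
move=> hl1; case: (ltnP (R a) (R b)) => hab.
  have [u [R1 [a1 [h1 h2 h3 h4]]]] := H1 hab p _ hl1.
  exists u.+1, R1, ([:: a; b] ++ a1); split=> //.
  - by lia.
  - by rewrite /= ha hb.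
  move=> f; rewrite addSn (run_step _ _ hn) //= hab h4.
  have -> : pc + (csize c2).+2 + csize c1 = pc + (csize c2 + csize c1).+2 by lia.
  by rewrite emit_cat.
have [u [R1 [a1 [h1 h2 h3 h4]]]] := H2 hab p _ hl2.
exists u.+2, R1, ([:: a; b] ++ a1); split=> //.
- by rewrite /= ha hb.
move=> f; rewrite addSn addSnnS (run_step _ _ hn) //= ltnNge hab /=.
rewrite h4 (run_step _ _ hj) //= emit_cat.
by case: run => [[]|].
Qed.

(** The variant [f] bounds the remaining iterations, each costing the body and one test; the extra 2
    pays for the initial jump to the test and for the final failing test. *)
Lemma wp_while S a b c (I : regs -> Prop) (f : regs -> nat) t T R (Q : regs -> Prop) :
  a < S -> b < S -> f R * t.+1 + 2 <= T -> I R ->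
  (forall R, I R -> R a < R b -> wp S c R t (fun R' => I R' /\ f R' < f R)) ->
  (forall R, I R -> R b <= R a -> Q R) ->
  wp S (While a b c) R T Q.
Proof.
move=> ha hb hT hI hbody hQ p pc /= /located_cons[hj].
rewrite -cats1 => /located_cat[hl]; rewrite size_compile => /located_cons[hn _].
suff [u [R' [acc [h1 h2 h3 h4]]]] : exists u R' acc,
    [/\ u <= f R * t.+1 + 1, all (gtn S) acc, Q R' &
     forall g, run p (u + g) (pc.+1 + csize c) R =
               emit acc (run p g (pc + (csize c).+2) R')].
  exists u.+1, R', acc; split=> //; first by lia.
  move=> g; rewrite addSn (run_step _ _ hj) //= -addSnnS h4.
  by case: run => [[]|].
clear T hT; have [v] := ubnP (f R); elim: v R hI => // v IH R hI hv.
case: (ltnP (R a) (R b)) => hab; last first.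
  exists 1, R, [:: a; b]; split; first exact: leq_addl.
  - by rewrite /= ha hb.
  - exact: hQ.
  move=> g; rewrite add1n (run_step _ _ hn) //= ltnNge hab /=.
  by congr (emit _ (run _ _ _ _)); lia.
have [u [R1 [a1 [h1 h2 [h3 h3'] h4]]]] := hbody R hI hab p _ hl.
have [|u2 [R2 [a2 [g1 g2 g3 g4]]]] := IH R1 h3; first by lia.
exists (u + u2).+1, R2, ([:: a; b] ++ a1 ++ a2); split=> //.
- suff : f R1 * t.+1 + t.+1 <= f R * t.+1 by lia.
  by rewrite -mulSnr leq_mul2r h3' orbT.
- by rewrite !all_cat h2 g2 /= ha hb.
- move=> g; rewrite addSn (run_step _ _ hn) //= hab -addnA h4 g4 !emit_cat.
  by [].
Qed.

Lemma wp_seq_blk S s c R t Q :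
  all sequential s -> size s <= t -> blk_in S s R ->
  wp S c (blk_run s R) (t - size s) Q -> wp S (Seq (Blk s) c) R t Q.
Proof.
move=> h1 h2 h3 h4; rewrite -(subnKC h2); apply: wp_seq.
exact: wp_blk.
Qed.

Lemma wp_seq_conseq S c1 c2 R t1 t2 t (Q1 Q : regs -> Prop) :
  wp S c1 R t1 Q1 -> (forall R1, Q1 R1 -> wp S c2 R1 t2 Q) -> t1 + t2 <= t ->
  wp S (Seq c1 c2) R t Q.
Proof.
move=> h1 h2 ht; apply: (wp_conseq (wp_seq _) ht (fun _ h => h)).
exact: (wp_conseq h1 (leqnn _) h2).
Qed.

(** The program counter ends just past the code, where [nth] returns the default [IHalt]; this halt
    is the one additional step. *)
Lemma wp_run S c R t Q : wp S c R t Q -> exists R' acc,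
  [/\ run (compile c 0) t.+1 0 R = Some (R', acc), all (gtn S) acc & Q R'].
Proof.
move=> /(_ (compile c 0) 0 (fun j _ => erefl)) [u [R' [acc [h1 h2 h3 h4]]]].
exists R', acc; split=> //.
have -> : t.+1 = u + (t - u).+1 by lia.
rewrite h4 /= add0n nth_default ?size_compile //=.
by rewrite cats0.
Qed.

(** * Counting unbordered words with a given prefix *)

(** Words grow at the right end, where periodicity and comparability with a prefix each add a single
    condition on the new letter. *)
Fixpoint kwords (k l : nat) : seq (seq nat) :=
  if l is l'.+1 then [seq rcons u a | u <- kwords k l', a <- iota 1 k]
  else [:: [::]].

Lemma mem_kwords k l w :
  (w \in kwords k l) = (size w == l) && all (fun a => 0 < a <= k) w.
Proof.
elim: l w => [|l IH] w /=; first by case: w.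
apply/allpairsP/idP => [[[u a] /= [hu ha ->]]|].
  move: hu; rewrite IH => /andP[/eqP hs hal].
  move: ha; rewrite mem_iota size_rcons all_rcons hs hal eqxx => /=; lia.
case/lastP: w => [//|u a]; rewrite size_rcons eqSS all_rcons => /and3P[hs ha hal].
exists (u, a); split=> //=; first by rewrite IH hs hal.
by rewrite mem_iota; lia.
Qed.

Lemma uniq_kwords k l : uniq (kwords k l).
Proof.
elim: l => [//|l IH] /=; apply: allpairs_uniq => //; first exact: iota_uniq.
by move=> [u a] [v b] _ _ /= /rcons_inj[-> ->].
Qed.

Lemma perm_words n k : perm_eq (words n k) (kwords k n).
Proof.
apply: uniq_perm; last 1 first.
- move=> w; rewrite mem_kwords; apply/mapP/andP => [[t _ ->]|[/eqP hs hal]].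
    rewrite size_map size_tuple; split=> //.
    by apply/allP=> a /mapP[i _ ->]; rewrite /= ltn_ord.
  have hsz : size (pmap (fun a => insub a.-1) w : seq 'I_k) == n.
    rewrite size_pmap -hs -all_count; apply/allP=> a /(allP hal) /andP[h1 h2] /=.
    by rewrite insubT //; lia.
  exists (Tuple hsz); first by rewrite mem_enum.
  rewrite /=; elim: w hal {hs hsz} => //= a w IH /andP[/andP[h1 h2] hal].
  rewrite insubT /=; first by lia.
  by move=> h /=; rewrite -IH // prednK.
- rewrite map_inj_uniq ?enum_uniq // => t1 t2 /(inj_map _) h.
  by apply/val_inj/h => i j [] /val_inj.
- exact: uniq_kwords.
Qed.

Lemma count_kwordsS k l (P : pred (seq nat)) :
  count P (kwords k l.+1) =
  \sum_(u <- kwords k l) count (fun a => P (rcons u a)) (iota 1 k).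
Proof.
rewrite /= count_flatten -map_comp sumnE big_map.
by apply: eq_bigr => u _; rewrite /= count_map.
Qed.

(** * Prefix comparability, periods and borders *)

Definition compat (x w : seq nat) : bool := take (size x) w == take (size w) x.

Lemma compat_rcons x u a : compat x (rcons u a) =
  compat x u && ((size u < size x) ==> (a == nth 0 x (size u))).
Proof.
rewrite /compat size_rcons; case: (ltnP (size u) (size x)) => h.
  rewrite take_oversize ?size_rcons // (take_nth 0) // eqseq_rcons.
  by rewrite [take (size x) u]take_oversize // ltnW.
by rewrite -cats1 takel_cat // andbT (take_oversize h) [take _.+1 x]take_oversize // ltnW.
Qed.

Lemma nth_compat x u j : compat x u -> j < size u -> j < size x ->
  nth 0 u j = nth 0 x j.
Proof.
move=> /eqP h h1 h2.
by rewrite -(nth_take 0 h2) h nth_take.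
Qed.

(** A border of length [i] is the same as a period [size w - i]; periods are easier to follow while
    a word is being extended. *)
Definition has_period (s : nat) (w : seq nat) : bool :=
  drop s w == take (size w - s) w.

Lemma has_periodP s w :
  reflect (forall j, s + j < size w -> nth 0 w (s + j) = nth 0 w j)
          (has_period s w).
Proof.
apply: (iffP eqP) => [h j hj|h].
  by rewrite -nth_drop h nth_take //; lia.
apply: (@eq_from_nth _ 0) => [|j]; rewrite size_drop.
  by rewrite size_take; case: ltnP; lia.
by move=> hj; rewrite nth_drop nth_take // h //; lia.
Qed.

Lemma has_period_small s w : size w <= s -> has_period s w.
Proof. by move=> h; apply/has_periodP=> j; lia. Qed.

Lemma has_period_rcons s u a : 0 < s -> has_period s (rcons u a) =
  has_period s u && ((s <= size u) ==> (a == nth 0 u (size u - s))).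
Proof.
move=> s0; case: (leqP s (size u)) => h; last first.
  by rewrite !has_period_small ?size_rcons // ltnW.
rewrite /has_period size_rcons drop_rcons // subSn // -[rcons u a]cats1 takel_cat; last by lia.
by rewrite (take_nth 0) ?eqseq_rcons //; lia.
Qed.

Lemma unborderedP w :
  reflect (forall i, 0 < i < size w -> ~~ has_period (size w - i) w)
          (unbordered w).
Proof.
have E i : i < size w -> has_period (size w - i) w =
    prefix (take i w) w && suffix (take i w) w.
  move=> hi; rewrite prefix_take suffixE size_take hi /has_period /=.
  by rewrite subKn // ltnW.
apply: (iffP forallP) => [h i /andP[i0 hi]|h i].
  by have := h (Ordinal hi); rewrite i0 /= -E.
by apply/implyP=> i0; rewrite -E ?h ?i0 /=.
Qed.

Lemma unbordered_nil : unbordered [::].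
Proof. by apply/unborderedP=> i /andP[_]; rewrite ltn0. Qed.

(* The unbordered border of a bordered word is its shortest border, which cannot
   overlap itself since the overlap would be a shorter border. *)
Lemma unbordered_border_unique l w : size w = l ->
  unbordered w +
  \sum_(1 <= i < l./2.+1) (unbordered (take i w) && has_period (l - i) w) = 1.
Proof.
move=> hl; case: (boolP (unbordered w)) => [/unborderedP h|hb].
  rewrite big_nat big1 // => i hi.
  by rewrite -hl (negbTE (h i _)) ?andbF //; lia.
have ex : exists i, (0 < i < l) && has_period (l - i) w.
  have : ~~ [forall i : 'I_l, (0 < i) ==> ~~ has_period (l - i) w].
    apply: contra hb => /forallP h; apply/unborderedP => i.
    rewrite hl => /andP[i1 i2].
    by have := h (Ordinal i2); rewrite /= i1.
  case/forallPn=> i; rewrite negb_imply negbK => /andP[h1 h2].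
  by exists i; rewrite h1 ltn_ord.
case: (ex_minnP ex) => i0 /andP[hi0 hp0] hmin.
have hu0 : unbordered (take i0 w).
  have st : size (take i0 w) = i0 by rewrite size_take; case: ltnP; lia.
  apply/unborderedP => i; rewrite st => hi; apply/negP => hp.
  (* A border of a border of [w] is again a border of [w], so minimality of [i0] applies. *)
  suff : i0 <= i by lia.
  apply: hmin; apply/andP; split; first by lia.
  apply/has_periodP => j; rewrite hl => hj.
  move/has_periodP: hp; rewrite st => /(_ j); rewrite !nth_take; [|lia|lia].
  move=> <-; last by lia.
  move/has_periodP: hp0; rewrite hl => /(_ (i0 - i + j)) <-; last by lia.
  by congr nth; lia.
have h2 : i0 <= l./2.
  rewrite leqNgt; apply/negP=> hlt.
  (* Doubling the period [l - i0] gives a border of length [2 * i0 - l], which is positive and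
     shorter than [i0]. *)
  suff : i0 <= i0 - (l - i0) by lia.
  apply: hmin; apply/andP; split; first by lia.
  move/has_periodP: hp0; rewrite hl => hp0.
  apply/has_periodP => j; rewrite hl => hj.
  rewrite -(hp0 j); last by lia.
  rewrite -(hp0 (l - i0 + j)); last by lia.
  by congr nth; lia.
rewrite add0n (bigD1_seq i0) ?iota_uniq ?mem_index_iota //=; last by lia.
rewrite hu0 hp0 /= big_nat_cond big1 // => i /andP[hi ne].
case: (boolP (unbordered _ && _)) => // /andP[hu hp].
have lei : i0 <= i by apply: hmin; rewrite hp andbT; lia.
have st : size (take i w) = i by rewrite size_take; case: ltnP; lia.
move/unborderedP: hu; rewrite st => /(_ i0) h.
(* Any other border is longer than the shortest one and therefore has the shortest one as a border
   of its own. *)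
suff hp' : has_period (i - i0) (take i w) by move: h; rewrite hp'; lia.
apply/has_periodP => j; rewrite st => hj; rewrite !nth_take; [|lia|lia].
move/has_periodP: hp; rewrite hl => /(_ (i - i0 + j)) <-; last by lia.
move/has_periodP: hp0; rewrite hl => /(_ j) <-; last by lia.
by congr nth; lia.
Qed.

(** * Recurrence for the number of comparable unbordered words *)

(* The number of letters that may stand at position [q] of a word compatible
   with [x] and with period [s], once the preceding letters are chosen. *)
Definition choices (k m : nat) (x : nat -> nat) (s q : nat) : nat :=
  if q < m then (if q < s then 1 else (x q == x (q - s)))
  else (if q < s then k else 1).

Definition unb_compat (k : nat) (x : seq nat) (l : nat) : nat :=
  count (fun w => unbordered w && compat x w) (kwords k l).

Lemma count_eq_iota k a : count (pred1 a) (iota 1 k) = (0 < a <= k).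
Proof. by rewrite count_uniq_mem ?iota_uniq // mem_iota; congr nat_of_bool; lia. Qed.

(** Induction on the length, starting from the prefix of length [i]. As [i.*2 <= l], the period
    [l - i] does not constrain that prefix, and each later position has a number of admissible
    letters independent of the word built so far. *)
Lemma count_border k x l i : all (fun a => 0 < a <= k) x ->
  0 < l -> i.*2 <= l ->
  count (fun u => [&& unbordered (take i u), compat x u & has_period (l - i) u])
        (kwords k l) =
  unb_compat k x i * \prod_(i <= q < l) choices k (size x) (nth 0 x) (l - i) q.
Proof.
move=> hx l0 hi.
have hq : i + (l - i) = l by lia.
set s := l - i.
suff H d : count (fun u => [&& unbordered (take i u), compat x u & has_period s u])
        (kwords k (i + d)) =
    unb_compat k x i * \prod_(i <= q < i + d) choices k (size x) (nth 0 x) s q.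
  by have := H s; rewrite /s hq.
elim: d => [|d IH].
  rewrite addn0 big_geq // muln1; apply: eq_in_count => u.
  rewrite mem_kwords => /andP[/eqP su _]; rewrite take_oversize ?su // has_period_small ?andbT //.
  by rewrite su /s; lia.
rewrite addnS count_kwordsS big_nat_recr ?leq_addr //= mulnA -IH.
set c := choices _ _ _ _ _.
rewrite -sum1_count big_distrl /= [RHS]big_mkcond /=.
rewrite big_seq [RHS]big_seq; apply: eq_bigr => u.
rewrite mem_kwords => /andP[/eqP su hu].
have s0 : 0 < s by rewrite /s; lia.
have -> : count (fun a => [&& unbordered (take i (rcons u a)),
    compat x (rcons u a) & has_period s (rcons u a)]) (iota 1 k) =
  count (fun a => [&& unbordered (take i u),
    compat x u && ((i + d < size x) ==> (a == nth 0 x (i + d)))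
    & has_period s u && ((s <= i + d) ==> (a == nth 0 u (i + d - s)))]) (iota 1 k).
  apply: eq_count => a; rewrite has_period_rcons // compat_rcons su.
  by rewrite -cats1 takel_cat // su leq_addr.
case: (boolP (unbordered _)) => _ /=; last exact: count_pred0.
case: (boolP (compat x u)) => hc /=; last exact: count_pred0.
case: (boolP (has_period _ _)) => _ /=; last first.
  by under eq_count => a do rewrite andbF; exact: count_pred0.
rewrite mul1n /c /choices.
have nthP y j : all (fun a => 0 < a <= k) y -> j < size y -> 0 < nth 0 y j <= k.
  by move=> /all_nthP hy hj; exact: hy.
case: ltnP => h1 /=; case: ltnP => h2 /=.
- by under eq_count => a do rewrite andbT; rewrite (count_eq_iota k) nthP.
(* The letter is prescribed both by [x] and by the period. The earlier position also lies within
   [x], so whether the two prescriptions agree depends on [x] alone. *)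
- rewrite -(@nth_compat x u (i + d - s)) ?su //; try lia.
  case: eqVneq => e.
    under eq_count => a do rewrite e andbb.
    by rewrite (count_eq_iota k) nthP // su; lia.
  rewrite -(@eq_count _ pred0) ?count_pred0 // => a /=.
  by apply/esym/negbTE; apply: contra e => /andP[/eqP <- /eqP <-].
- by rewrite count_predT size_iota.
- by rewrite (count_eq_iota k) nthP // su; lia.
Qed.

(** For [i = 0] the period [l] imposes nothing; with [V 0 = 1] the term counts all words of length
    [l] comparable with [x]. One routine thus computes both parts of the recurrence. *)
Definition border_term (k m : nat) (x V : nat -> nat) (l i : nat) : nat :=
  V i * \prod_(i <= q < l) choices k m x (l - i) q.

Lemma unb_compat0 k x : unb_compat k x 0 = 1.
Proof.
rewrite /unb_compat /= /compat take0 eqxx andbT addn0.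
by rewrite unbordered_nil.
Qed.

(** Summing [unbordered_border_unique] over the comparable words and exchanging the two sums gives
    an additive identity, so the truncated subtraction is exact. *)
Lemma unb_compat_rec k x l : all (fun a => 0 < a <= k) x -> 0 < l ->
  unb_compat k x l =
  border_term k (size x) (nth 0 x) (unb_compat k x) l 0 -
  \sum_(1 <= i < l./2.+1) border_term k (size x) (nth 0 x) (unb_compat k x) l i.
Proof.
move=> hx l0; rewrite /border_term -count_border ?double0 //.
rewrite (eq_big_nat _ _ (F2 := fun i => count (fun u => [&& unbordered (take i u),
  compat x u & has_period (l - i) u]) (kwords k l))); last first.
  by move=> i hi; rewrite -count_border //; lia.
suff -> : count (fun u => [&& unbordered (take 0 u), compat x u & has_period (l - 0) u]) (kwords k l) =
  unb_compat k x l + \sum_(1 <= i < l./2.+1) count (fun u => [&& unbordered (take i u),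
  compat x u & has_period (l - i) u]) (kwords k l) by rewrite addnK.
under [in RHS]eq_bigr => i _ do rewrite -sum1_count big_mkcond.
rewrite exchange_big /unb_compat -!sum1_count /= big_mkcond [in RHS]big_mkcond -big_split /=.
rewrite big_seq [RHS]big_seq; apply: eq_bigr => u.
rewrite mem_kwords => /andP[/eqP su hu].
rewrite take0 unbordered_nil has_period_small ?su ?subn0 // andbT.
case: (compat x u); rewrite /= ?andbT ?andbF.
  by rewrite -[LHS](unbordered_border_unique su).
by rewrite big1 // => i _; rewrite andbF.
Qed.

(** * Prefix ranks and their change with the last letter *)

(* For an unbordered [x] of length [n], this is the rank of [x] minus one. *)
Definition prefix_rank (n k : nat) (x : seq nat) : nat :=
  count (fun w => unbordered w && lexlt (take (size x) w) x) (kwords k n).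

Lemma lexlt_irr x : lexlt x x = false.
Proof. by elim: x => //= a x ->; rewrite ltnn andbF. Qed.

Lemma lexlt_rcons u x b a : size u = size x ->
  lexlt (rcons u b) (rcons x a) = lexlt u x || (u == x) && (b < a).
Proof.
elim: u x => [|c u IH] [|d x] //=; first by rewrite andbF orbF.
by case=> /IH ->; rewrite eqseq_cons -orbA; case: (c == d).
Qed.

Lemma count_add (T : eqType) (s : seq T) (P P1 P2 : pred T) :
  {in s, forall w, (P w : nat) = P1 w + P2 w} ->
  count P s = count P1 s + count P2 s.
Proof.
elim: s => //= w s IH h; rewrite IH; last by move=> v hv; rewrite h // inE hv orbT.
by rewrite h ?mem_head // addnACA.
Qed.

Lemma take_rcons_kwords n k m w : m < n -> w \in kwords k n ->
  take m.+1 w = rcons (take m w) (nth 0 w m) /\ size (take m w) = m.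
Proof.
rewrite mem_kwords => h /andP[/eqP sw _].
by rewrite (take_nth 0) ?sw // size_take sw h.
Qed.

Lemma nth_kwords n k m w : m < n -> w \in kwords k n -> 0 < nth 0 w m <= k.
Proof.
rewrite mem_kwords => h /andP[/eqP sw /all_nthP]; apply.
by rewrite sw.
Qed.

Lemma compat_full n k x w : size x <= n -> w \in kwords k n ->
  compat x w = (take (size x) w == x).
Proof.
rewrite mem_kwords => h /andP[/eqP sw _].
by rewrite /compat sw [take n x]take_oversize.
Qed.

Lemma prefix_rankS n k x a : size x < n ->
  prefix_rank n k (rcons x a.+1) =
  prefix_rank n k (rcons x a) + unb_compat k (rcons x a) n.
Proof.
move=> hx; apply: count_add => w hw; rewrite (compat_full _ hw) !size_rcons //.
have [-> sw] := take_rcons_kwords hx hw.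
rewrite !lexlt_rcons // eqseq_rcons ltnS leq_eqVlt.
case: unbordered => //=; case: eqVneq => [->|_] /=; last by rewrite addn0.
by rewrite lexlt_irr /=; case: eqVneq => [->|]; rewrite ?ltnn //= addn0.
Qed.

(** The letter 0 lies outside the alphabet and is the starting value of the letter search. *)
Lemma prefix_rank_rcons0 n k x : size x < n ->
  prefix_rank n k (rcons x 0) = prefix_rank n k x.
Proof.
move=> hx; apply: eq_in_count => w hw; rewrite size_rcons.
have [-> sw] := take_rcons_kwords hx hw.
by rewrite lexlt_rcons // ltn0 andbF orbF.
Qed.

Lemma unb_compat_rcons0 n k x : size x < n -> unb_compat k (rcons x 0) n = 0.
Proof.
move=> hx; rewrite -[RHS](count_pred0 (kwords k n)); apply: eq_in_count => w hw.
rewrite (compat_full _ hw) size_rcons //.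
have [-> sw] := take_rcons_kwords hx hw.
have h0 := nth_kwords hx hw; rewrite eqseq_rcons.
by have -> : (nth 0 w (size x) == 0) = false; [lia | rewrite !andbF].
Qed.

(** The letter [k.+1] is the sentinel at the other end: it shows that the search cannot pass beyond
    [k]. *)
Lemma prefix_rank_rconsk n k x : size x < n ->
  prefix_rank n k (rcons x k.+1) = prefix_rank n k x + unb_compat k x n.
Proof.
move=> hx; apply: count_add => w hw.
rewrite (compat_full _ hw) ?size_rcons; last exact: ltnW.
have [-> sw] := take_rcons_kwords hx hw.
have /andP[_ hk] := nth_kwords hx hw.
rewrite lexlt_rcons // ltnS hk andbT.
by case: unbordered => //=; case: eqVneq => [->|_]; rewrite ?lexlt_irr ?orbF ?addn0.
Qed.

Lemma prefix_rank_nil n k : prefix_rank n k [::] = 0.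
Proof.
rewrite -[RHS](count_pred0 (kwords k n)); apply: eq_count => w.
by rewrite take0 andbF.
Qed.

Lemma unb_compat_nil n k : unb_compat k [::] n = size (unbordered_words n k).
Proof.
rewrite size_filter (permP (perm_words n k)).
by apply: eq_count => w; rewrite /compat take0 eqxx andbT.
Qed.

(** At full length comparability is equality, so the count is 0 or 1; its positivity forces [r = 1]
    and makes [x] unbordered. *)
Lemma has_rank_full_prefix n k r x : size x = n -> 0 < r <= unb_compat k x n ->
  has_rank n k (r + prefix_rank n k x) x.
Proof.
move=> sx /andP[r0 hr].
have E w : w \in kwords k n -> compat x w = (w == x).
  move=> hw; rewrite (compat_full _ hw) ?sx //.
  by move: hw; rewrite mem_kwords => /andP[/eqP <- _]; rewrite take_size.
have hu : unb_compat k x n = (unbordered x && (x \in kwords k n)).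
  transitivity (count (fun w => unbordered x && (w == x)) (kwords k n)).
    apply: eq_in_count => w hw; rewrite E //.
    by case: eqVneq => [->|_]; rewrite ?andbF.
  case: unbordered => /=; last exact: count_pred0.
  exact: (count_uniq_mem _ (uniq_kwords k n)).
have hx : unbordered x && (x \in kwords k n) by move: hr; rewrite hu; case: (_ && _); lia.
have r1 : r = 1 by move: hr; rewrite hu hx; lia.
split; first by rewrite mem_filter (perm_mem (perm_words n k)).
rewrite count_filter (permP (perm_words n k)) r1 add1n /=.
apply: eq_in_count => w; rewrite mem_kwords => /andP[/eqP sw _] /=.
by rewrite sx -sw take_size andbC.
Qed.

(** * The program *)

(* Register layout: 0 remaining rank, 1 [n], 2 [k], 3 the constant 1, 4 the base
   [20 + n] of the word array, 5 the base [20 + 2 n] of the array [V], 6 the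
   length of the current prefix, 7 the address of its last letter, 8 that letter,
   9 the current value of [V], 10 the length [l], 11 [n + 1], 12 the border
   length [i], 13 the border term, 14 [l / 2 + 1], 16 the position [q],
   17 [l - i]; 15, 18 and 19 are temporaries. *)

Definition agree_off (L : seq nat) (R R' : regs) : Prop :=
  forall j, j \notin L -> R' j = R j.

Ltac upd_simpl :=
  rewrite /= /upd /=;
  repeat match goal with
  | |- context [if ?a == ?b then _ else _] =>
      first [ have -> : (a == b) = false by lia
            | have -> : (a == b) = true by lia ]
  end.

Definition term_vars := [:: 13; 15; 16; 17; 18; 19].

Definition term_cmd : cmd :=
  Seq (Blk [:: IMul 16 12 3; ISub 17 10 12; IAdd 18 5 12; ILoad 13 18])
 (While 16 10
   (Seq
     (If 16 6
       (If 16 17 (Blk [::])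
         (* multiplies by [1 - ((a - b) + (b - a))], which is [a == b] *)
         (Blk [:: IAdd 18 4 16; ILoad 18 18; ISub 19 16 17; IAdd 19 4 19;
                  ILoad 19 19; ISub 15 18 19; ISub 18 19 18; IAdd 15 15 18;
                  ISub 15 3 15; IMul 13 13 15]))
       (If 16 17 (Blk [:: IMul 13 13 2]) (Blk [::])))
     (Blk [:: IAdd 16 16 3]))).

(** Stores are rejected because their target depends on the register contents. *)
Definition writes_in (L : seq nat) (i : instr) : bool :=
  match i with
  | IConst d _ | IAdd d _ _ | ISub d _ _ | IMul d _ _ | IDiv d _ _
  | IMod d _ _ | ILoad d _ => d \in L
  | _ => false
  end.

Lemma agree_off_upd L R R' d v : agree_off L R R' -> d \in L ->
  agree_off L R (upd R' d v).
Proof.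
move=> h hd j hj; rewrite /upd; case: eqP => [e|_]; last exact: h.
by move: hj; rewrite e hd.
Qed.

Lemma agree_off_blk L s R R' : all (writes_in L) s -> agree_off L R R' ->
  agree_off L R (blk_run s R').
Proof.
elim: s R' => //= i s IH R' /andP[hi hs] h; apply: IH => //.
by case: i hi => //= *; exact: agree_off_upd.
Qed.

Lemma agree_off_trans L R1 R2 R3 :
  agree_off L R1 R2 -> agree_off L R2 R3 -> agree_off L R1 R3.
Proof. by move=> h1 h2 j hj; rewrite h2 // h1. Qed.

(** Register 3 holds 1, so multiplying by it copies a register. The arrays start at 20 or above, out
    of reach of the scratch registers. *)
Lemma wp_term S R n :
  R 3 = 1 -> 20 <= R 4 -> 20 <= R 5 -> R 4 + n < S -> R 5 + n < S ->
  R 12 <= R 10 <= n ->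
  wp S term_cmd R (16 * n + 6) (fun R' => agree_off term_vars R R' /\
    R' 13 = border_term (R 2) (R 6) (fun j => R (R 4 + j)) (fun j => R (R 5 + j))
              (R 10) (R 12)).
Proof.
move=> h3 h4 h5 hS4 hS5 hi.
set V := R (R 5 + R 12).
set F := choices (R 2) (R 6) (fun j => R (R 4 + j)) (R 10 - R 12).
pose I R' := [/\ agree_off term_vars R R', R' 17 = R 10 - R 12,
   R 12 <= R' 16 <= R 10 & R' 13 = V * \prod_(R 12 <= q < R' 16) F q].
apply: wp_seq_blk => //; first by rewrite /=; lia.
  by upd_simpl; lia.
set R1 := blk_run _ _.
have R116 : R1 16 = R 12 by rewrite /R1; upd_simpl; rewrite h3 muln1.
apply: (@wp_while S 16 10 _ I (fun R' => R 10 - R' 16) 15); try (rewrite /= ?R116; lia).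
- rewrite /R1; by split; [exact: agree_off_blk | upd_simpl.. | upd_simpl; rewrite h3 muln1 big_geq // muln1];
    rewrite ?h3; lia.
- move=> R' [ha h17 h16 h13]; rewrite (ha 10) // => hlt.
  have hT : V * \prod_(R 12 <= q < (R' 16).+1) F q = R' 13 * F (R' 16).
    by rewrite big_nat_recr /=; [rewrite mulnA h13 | lia].
  (* The longest branch costs 14: two nested conditionals at 2 each and a block of ten
     instructions. *)
  apply: (@wp_seq_conseq _ _ _ _ 14 1 _ (fun R2 =>
     [/\ agree_off term_vars R R2, R2 17 = R 10 - R 12, R2 16 = R' 16 &
         R2 13 = R' 13 * F (R' 16)])) => //.
  + rewrite /F /choices -h17.
    have E6 := ha 6 isT; have E4 := ha 4 isT; have E2 := ha 2 isT.
    have E3 := ha 3 isT.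
    have Eh j : R' (R 4 + j) = R (R 4 + j) by apply: ha; rewrite !inE; lia.
    apply: wp_if; [lia|lia| |]; rewrite E6 => hm; [rewrite hm | rewrite ltnNge hm /=];
      apply: wp_if; [lia|lia| | |lia|lia| |] => hs;
      [rewrite hs | rewrite ltnNge hs /= | rewrite hs | rewrite ltnNge hs /=].
    * by apply: wp_blk => //; split; rewrite /= ?muln1.
    * apply: wp_blk => //; first by upd_simpl; lia.
      split; [exact: agree_off_blk | by upd_simpl.. | upd_simpl].
      rewrite E4 !Eh E3 h3; congr (_ * _); case: eqP => /=; lia.
    * apply: wp_blk => //; first by upd_simpl; lia.
      by split; [exact: agree_off_blk | upd_simpl.. | upd_simpl; rewrite E2].
    * by apply: wp_blk => //; split; rewrite /= ?muln1.
  + move=> R2 [ga g17 g16 g13]; have g3 := ga 3 isT.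
    apply: wp_blk => //; first by upd_simpl; lia.
    split; last by upd_simpl; lia.
    split; [exact: agree_off_blk | by upd_simpl | | ]; upd_simpl; rewrite g16 g3 h3 ?addn1; first by lia.
    by rewrite hT g13.
- move=> R2 [ga g17 g16 g13]; rewrite (ga 10) // => hge; split=> //.
  by rewrite g13 /border_term; have -> : R2 16 = R 10 by lia.
Qed.

(** * Filling the table of counts *)

Lemma eq_border_term k m x x' V V' l i :
  (forall j, j < m -> x j = x' j) -> V i = V' i ->
  border_term k m x V l i = border_term k m x' V' l i.
Proof.
move=> hx hV; rewrite /border_term hV; congr (_ * _); apply: eq_bigr => q _.
by rewrite /choices; case: ltnP => // hq; rewrite !hx //; lia.
Qed.

Lemma agree_off_sub L L' R R' : {subset L <= L'} -> agree_off L R R' ->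
  agree_off L' R R'.
Proof. by move=> h hR j hj; apply: hR; apply: contra hj; apply: h. Qed.

Definition sum_vars := [:: 9; 12; 14] ++ term_vars.

Definition count_vars := 10 :: sum_vars.

Lemma notin_sum_vars j : j \notin count_vars -> j \notin sum_vars.
Proof. by rewrite inE negb_or => /andP[]. Qed.

Definition sum_cmd : cmd :=
  While 12 14 (Seq term_cmd (Blk [:: ISub 9 9 13; IAdd 12 12 3])).

Definition count_cmd : cmd :=
  Seq (Blk [:: IConst 10 1; IConst 9 1])
 (While 10 11
   (Seq (Blk [:: IConst 12 0])
   (Seq term_cmd
   (Seq (Blk [:: IMul 9 13 3; IConst 12 1; IConst 14 2; IDiv 14 10 14; IAdd 14 14 3])
   (Seq sum_cmd
   (Blk [:: IAdd 18 5 10; IStore 18 9; IAdd 10 10 3])))))).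

(** The table is filled in increasing [l]. Among the cells from 20 on, only those above [R 5] are
    overwritten; cell [R 5], holding [V 0 = 1], survives, so the routine can be called again for the
    next prefix. *)
Lemma wp_count S R n x V :
  0 < n -> R 3 = 1 -> R 11 = n.+1 -> 20 <= R 4 -> R 5 = R 4 + n ->
  R 5 + n < S -> (forall j, j < R 6 -> R (R 4 + j) = x j) ->
  R 6 <= n -> V 0 = 1 -> R (R 5) = 1 ->
  (forall l, 0 < l -> V l = border_term (R 2) (R 6) x V l 0 -
     \sum_(1 <= i < l./2.+1) border_term (R 2) (R 6) x V l i) ->
  wp S count_cmd R (70 * n ^ 3) (fun R' =>
    (forall j, j \notin count_vars -> j <= R 5 -> R' j = R j) /\ R' 9 = V n).
Proof.
move=> n0 h3 h11 h4 h5 hS hx h6 V0 R50 hV.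
pose I R' := [/\ forall j, j \notin count_vars -> j <= R 5 -> R' j = R j,
  0 < R' 10 <= n.+1, forall j, j < R' 10 -> R' (R 5 + j) = V j &
  R' 9 = V (R' 10).-1].
have n3 : n <= n * n <= n ^ 3 by rewrite !expnS expn0; nia.
apply: wp_seq_blk => //=; [by lia|by upd_simpl; lia|].
set R1 := upd _ _ _.
have R110 : R1 10 = 1 by [].
(* The body costs [16 * n + 7] for the term with [i = 0], and at most [16 * (n * n) + 9 * n + 10]
   for the subtraction loop and its surrounding blocks. *)
apply: (@wp_while S 10 11 _ I (fun R' => n.+1 - R' 10) (16 * (n * n) + 25 * n + 17)); try lia.
- split; rewrite /R1.
  + move=> j; rewrite !inE !negb_or => hj hj5; upd_simpl; by [].
  + by upd_simpl.
  + by move=> j; upd_simpl => hj; (have -> : j = 0 by lia); rewrite addn0 V0.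
  + by upd_simpl.
- move=> A [hA hl hVA hA9]; rewrite (hA 11) // ?h11; last by lia.
  move=> hlt.
  set l := A 10 in hl hlt hVA hA9 *.
  have E j : j < 20 -> j \notin count_vars -> A j = R j by move=> *; apply: hA => //; lia.
  pose bt := border_term (R 2) (R 6) x V l.
  have wpt B : agree_off sum_vars A B -> B 12 < l -> wp S term_cmd B (16 * n + 6)
     (fun R2 => [/\ agree_off sum_vars A R2, R2 9 = B 9, R2 12 = B 12,
                    R2 14 = B 14 & R2 13 = bt (B 12)]).
    move=> hB hi.
    have F j : j < 20 -> j \notin count_vars -> B j = R j.
      move=> j20 hj; by rewrite hB ?E // notin_sum_vars.
    have F10 : B 10 = l by rewrite hB.
    have Fh j : 20 <= j -> B j = A j by move=> hj; apply: hB; rewrite !inE; lia.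
    have F2 := F 2 isT isT; have F3 := F 3 isT isT; have F4 := F 4 isT isT.
    have F5 := F 5 isT isT; have F6 := F 6 isT isT.
    apply: (wp_conseq (@wp_term S B n _ _ _ _ _ _)) => //; try lia.
    rewrite F2 F4 F5 F6 F10.
    move=> R2 [g1 g2]; split; try by rewrite g1.
      by apply: (agree_off_trans hB); apply: agree_off_sub g1; move=> j; rewrite mem_cat => ->; rewrite orbT.
    rewrite g2; apply: eq_border_term => [j hj|].
      by rewrite Fh ?hA ?hx //; rewrite ?inE; lia.
    by rewrite Fh ?hVA //; lia.
  apply: wp_seq_blk => //; [by rewrite /=; lia|by upd_simpl; lia|].
  apply: (wp_seq_conseq (wpt _ _ _)).
  + exact: agree_off_upd.
  + by upd_simpl; lia.
  + move=> B [gB _ _ _]; upd_simpl => gT.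
    have F j : j < 20 -> j \notin count_vars -> B j = R j.
      move=> j20 hj; by rewrite gB ?E // notin_sum_vars.
    have F10 : B 10 = l by rewrite gB.
    apply: (@wp_seq_blk _ _ _ _ (16 * (n * n) + 9 * n + 10)) => //; [by rewrite /=; lia|by upd_simpl; lia|].
    set B1 := blk_run _ _.
    have B1E : [/\ agree_off sum_vars A B1, B1 9 = bt 0, B1 12 = 1 & B1 14 = l./2.+1].
      split; rewrite /B1; [exact: agree_off_blk|upd_simpl..].
      - by rewrite gT F // h3 muln1.
      - by [].
      - by rewrite F10 F // h3 divn2 addn1.
    case: B1E => g1 g9 g12 g14.
    pose J D := [/\ agree_off sum_vars A D, 0 < D 12 <= l./2.+1, D 14 = l./2.+1 &
       D 9 = bt 0 - \sum_(1 <= i < D 12) bt i].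
    apply: (@wp_seq_conseq _ _ _ _ (l./2 * (16 * n + 9) + 2) 3 _
      (fun D => [/\ agree_off sum_vars A D & D 9 = V l])).
    * apply: (@wp_while S 12 14 _ J (fun D => l./2.+1 - D 12) (16 * n + 8)); try lia.
      - by rewrite /= g12 subSS subn0 -addnS.
      - by split=> //; rewrite ?g12 // big_geq // subn0.
      - move=> D [k1 k2 k3 k4]; rewrite k3 => k5.
        apply: (@wp_seq_conseq _ _ _ _ _ 2 _ _ _ (wpt D k1 _)); [by lia| |by lia].
        move=> D2 [m1 m9 m12 m14 m13]; have D3 : D2 3 = 1 by rewrite m1 // E.
        apply: wp_blk => //; [by upd_simpl; lia|split; last by upd_simpl; lia].
        split; [exact: agree_off_blk|upd_simpl..].
        + by rewrite m12 D3; lia.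
        + by rewrite m14.
        + rewrite D3 addn1 m12 big_nat_recr; last by lia.
          by rewrite m9 m13 k4 subnDA.
      - move=> D [k1 k2 k3 k4] k5; split=> //; rewrite k4 hV; last by lia.
        by have -> : D 12 = l./2.+1 by lia.
    * move=> D [k1 k9].
      have G j : j < 20 -> j \notin count_vars -> D j = R j.
        move=> j20 hj; by rewrite k1 ?E // notin_sum_vars.
      have G10 : D 10 = l by rewrite k1.
      have G5 : D 5 = R 5 by rewrite G.
      have G3 : D 3 = 1 by rewrite G.
      apply: wp_blk => //; first by upd_simpl; rewrite ?G5 ?G10; lia.
      split; last by upd_simpl; lia.
      have Dh j : 20 <= j -> D j = A j by move=> hj; apply: k1; rewrite !inE; lia.
      split.
      - move=> j hj j5; have hs := notin_sum_vars hj.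
        rewrite -hA // -k1 //; move: hj; rewrite !inE !negb_or => hj.
        by upd_simpl.
      - by upd_simpl; lia.
      - move=> j; upd_simpl => hj; case: (eqVneq j l) => [->|ne].
          by upd_simpl; rewrite k9.
        by upd_simpl; rewrite Dh ?hVA //; lia.
      - by upd_simpl; rewrite G10 G3 addn1 /= k9.
    * by rewrite /=; (have : l./2 <= n by lia); nia.
  + by rewrite /=; nia.
- move=> D [k1 k2 k3 k4] k5; split=> //.
  by rewrite k4; congr V; move: k5; rewrite (k1 11) // ?h11; lia.
Qed.

(** * Letter-by-letter search and output *)

(** Entered with letter 0 and count 0, so the first pass subtracts nothing and tries letter 1. The
    loop stops once the remaining rank is at most the current count. *)
Definition letter_cmd : cmd :=
  While 9 0 (Seq (Blk [:: ISub 0 0 9; IAdd 8 8 3; IStore 7 8]) count_cmd).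

Definition search_cmd : cmd :=
  While 6 1
    (Seq (Blk [:: IAdd 7 4 6; IAdd 6 6 3; IConst 8 0; IConst 9 0]) letter_cmd).

(* The output occupies the registers [0 .. n - 1], which include the scratch
   registers.  Positions from 20 on are copied first; then each register [m < 19]
   is loaded using only itself and register 19, which holds the address of
   letter 19, and register 19 comes last. *)
Definition copy_high_cmd : cmd :=
  Seq (Blk [:: IConst 6 20])
      (While 6 1 (Blk [:: IAdd 7 4 6; ILoad 8 7; IStore 6 8; IAdd 6 6 3])).

Fixpoint copy_low_cmd (m : nat) : cmd :=
  if m is m'.+1 then
    Seq (copy_low_cmd m') (Blk [:: IConst m' (19 - m'); ISub m' 19 m'; ILoad m' m'])
  else Blk [::].

Definition unrank_cmd : cmd :=
  Seq (Blk [:: IConst 3 1; IConst 4 20; IAdd 4 4 1; IAdd 5 4 1; IAdd 11 1 3;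
               IStore 5 3; IConst 6 0])
 (Seq search_cmd
 (Seq copy_high_cmd
 (Seq (Blk [:: IConst 19 19; IAdd 19 19 4])
 (Seq (copy_low_cmd 19) (Blk [:: ILoad 19 19]))))).

Definition ready (n k : nat) (R : regs) : Prop :=
  [/\ R 1 = n, R 2 = k, R 3 = 1, R 4 = 20 + n &
  [/\ R 5 = 20 + n + n, R 11 = n.+1 & R (20 + n + n) = 1]].

Definition stores (n : nat) (x : seq nat) (R : regs) : Prop :=
  forall j, j < size x -> R (20 + n + j) = nth 0 x j.

(** Register 0 holds the rank of the sought word among the unbordered words that begin with [x]. *)
Definition search_inv (n k r : nat) (x : seq nat) (R : regs) : Prop :=
  [/\ ready n k R, R 6 = size x, size x <= n, stores n x R &
  [/\ all (fun a => 0 < a <= k) x, R 0 + prefix_rank n k x = r &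
      0 < R 0 <= unb_compat k x n]].

Lemma wp_letter S n k r x R : 3 * n + 40 < S ->
  size x < n -> all (fun a => 0 < a <= k) x ->
  r <= prefix_rank n k x + unb_compat k x n ->
  ready n k R -> R 6 = (size x).+1 -> R 7 = 20 + n + size x -> stores n x R ->
  R 8 = 0 -> R 9 = 0 -> 0 < R 0 -> R 0 + prefix_rank n k x = r ->
  wp S letter_cmd R (k * (70 * n ^ 3 + 4) + 2)
    (fun R' => exists a, search_inv n k r (rcons x a) R').
Proof.
move=> hS hx hal hr hR h6 h7 hst h8 h9 h0 hrk.
(* The initial letter 0 is never stored, whence the condition [0 < D 8] in the last clause. *)
pose J D := [/\ ready n k D, D 6 = (size x).+1, D 7 = 20 + n + size x, stores n x D &
  [/\ D 0 + prefix_rank n k (rcons x (D 8)) = r, 0 < D 0, D 8 <= k,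
      D 9 = unb_compat k (rcons x (D 8)) n &
      0 < D 8 -> D (20 + n + size x) = D 8]].
apply: (@wp_while S 9 0 _ J (fun D => k - D 8) (70 * n ^ 3 + 3)); try lia.
- split=> //; split=> //; rewrite ?h8 //; first by rewrite prefix_rank_rcons0.
  by rewrite unb_compat_rcons0.
- move=> D [[d1 d2 d3 d4 [d5 d11 dV]] d6 d7 ds [drk d0 d8 d9 da]] hlt.
  have hrk' : D 0 - D 9 + prefix_rank n k (rcons x (D 8).+1) = r.
    by rewrite prefix_rankS // -drk -d9; lia.
  (* If letter [k] were passed too, the ranks of all words with prefix [x] would be used up, against
     the upper bound on [r]. *)
  have hk : D 8 < k.
    rewrite ltn_neqAle d8 andbT; apply/eqP=> e.
    by move: hrk'; rewrite e prefix_rank_rconsk //; lia.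
  apply: wp_seq_blk => //; [by rewrite /=; lia|by upd_simpl; lia|].
  set D1 := blk_run _ _; set y := rcons x (D 8).+1.
  have sy : size y = (size x).+1 by rewrite size_rcons.
  have e j : j < 20 -> j != 0 -> j != 8 -> D1 j = D j.
    by move=> *; rewrite /D1; upd_simpl.
  have e0 : D1 0 = D 0 - D 9 by rewrite /D1; upd_simpl.
  have e8 : D1 8 = (D 8).+1 by rewrite /D1; upd_simpl; rewrite d3 addn1.
  have eh j : 20 <= j -> D1 j = if j == 20 + n + size x then (D 8).+1 else D j.
    move=> hj; rewrite /D1 /= /upd /= d7; case: eqP => [ej|_]; first by rewrite d3 addn1.
    by upd_simpl.
  have sty : stores n y D1.
    move=> j; rewrite sy ltnS leq_eqVlt eh; last by lia.
    case/orP=> [/eqP ->|hj]; first by rewrite eqxx nth_rcons ltnn eqxx.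
    by rewrite nth_rcons hj -ds //; upd_simpl.
  have ally : all (fun a => 0 < a <= k) y by rewrite all_rcons hal andbT.
  have f2 : D1 2 = k by rewrite e.
  have f3 : D1 3 = 1 by rewrite e.
  have f4 : D1 4 = 20 + n by rewrite e.
  have f5 : D1 5 = 20 + n + n by rewrite e.
  have f6 : D1 6 = (size x).+1 by rewrite e.
  have f11 : D1 11 = n.+1 by rewrite e.
  have fV : D1 (20 + n + n) = 1 by rewrite eh; [upd_simpl | lia].
  have /= := @wp_count S D1 n (nth 0 y) (unb_compat k y).
  move=> /(_ _ f3 f11) H; apply: wp_conseq (H _ _ _ _ _ _ _ _ _) _ _; rewrite ?f4 ?f5 ?f6; try lia.
  + by move=> j hj; apply: sty; rewrite sy.
  + exact: unb_compat0.
  + by move=> l l0; rewrite f2 -sy; apply: unb_compat_rec.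
  move=> D2 [g g9].
  have g' j : j < 20 -> j \notin count_vars -> D2 j = D1 j by move=> *; apply: g => //; lia.
  split; last by rewrite g' // e8; lia.
  split.
  + split; [by rewrite g' // e..|split; [by rewrite g' // e..|]].
    by rewrite g //; rewrite !inE; lia.
  + by rewrite g'.
  + by rewrite g' // e.
  + move=> j hj; rewrite g; [|by rewrite !inE; lia|by lia].
    by rewrite sty ?sy ?nth_rcons ?hj // ltnS ltnW.
  + split; rewrite ?(g' 0) ?(g' 8) ?e0 ?e8 //; first by lia.
    move=> _; rewrite g; [|by rewrite !inE; lia|by lia].
    by rewrite eh ?eqxx //; lia.
- move=> D [dR d6 d7 ds [drk d0 d8 d9 da]] hge.
  have a0 : 0 < D 8.
    rewrite lt0n; apply/eqP=> e; move: d9 hge; rewrite e unb_compat_rcons0 //; lia.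
  exists (D 8); split=> //; rewrite ?size_rcons //.
    move=> j; rewrite size_rcons ltnS leq_eqVlt nth_rcons.
    case/orP=> [/eqP ->|hj]; first by rewrite ltnn eqxx da.
    by rewrite hj ds.
  split=> //; first by rewrite all_rcons a0 d8.
  by rewrite d0 -d9.
Qed.

Lemma wp_search S n k r R : 3 * n + 40 < S -> 0 < n -> ready n k R -> R 6 = 0 ->
  R 0 = r -> 0 < r <= size (unbordered_words n k) ->
  wp S search_cmd R (n * (k * (70 * n ^ 3 + 4) + 7) + 2)
    (fun R' => exists2 x, size x = n & search_inv n k r x R').
Proof.
move=> hS n0 hR h6 h0 hr.
apply: (@wp_while S 6 1 _ (fun D => exists x, search_inv n k r x D)
  (fun D => n - D 6) (k * (70 * n ^ 3 + 4) + 6)); try lia.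
- exists [::]; split=> //; split=> //; first by rewrite prefix_rank_nil addn0.
  by rewrite h0 unb_compat_nil.
- move=> D [x [[d1 d2 d3 d4 [d5 d11 dV]] d6 sx ds [hal drk d0]]]; rewrite d1 d6 => hlt.
  apply: wp_seq_blk => //; [by rewrite /=; lia|by upd_simpl; lia|].
  set D1 := blk_run _ _.
  have e j : j \notin [:: 6; 7; 8; 9] -> D1 j = D j.
    by move: j; apply: (@agree_off_blk [:: 6; 7; 8; 9]).
  have eh j : 20 <= j -> D1 j = D j by move=> hj; apply: e; rewrite !inE; lia.
  have /= H := @wp_letter S n k r x D1 hS hlt hal.
  apply: (wp_conseq (H _ _ _ _ _ _ _ _ _)).
  + by rewrite -drk; lia.
  + by split; rewrite ?e //; split; rewrite ?e // eh //; lia.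
  + by rewrite /D1; upd_simpl; rewrite d6 d3 addn1.
  + by rewrite /D1; upd_simpl; rewrite d4 d6.
  + by move=> j hj; rewrite eh ?ds //; lia.
  + by [].
  + by [].
  + by rewrite e //; lia.
  + by rewrite e.
  + by rewrite /=; lia.
  + move=> D2 [a hI]; split; first by exists (rcons x a).
    by case: hI => _ -> _ _ _; rewrite size_rcons; lia.
- move=> D [x hI] hge; exists x => //.
  by case: hI => -[e1 _ _ _ _] e6 sx _ _; move: hge; rewrite e1 e6; lia.
Qed.

(** The targets lie below [n], hence below the word array at [20 + n], so no source cell is
    overwritten. *)
Lemma wp_copy_high S n x R : 3 * n + 40 < S -> size x = n -> R 1 = n -> R 3 = 1 ->
  R 4 = 20 + n -> stores n x R ->
  wp S copy_high_cmd R (5 * n + 3) (fun R' => [/\ R' 4 = 20 + n, stores n x R' &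
    forall j, 20 <= j < n -> R' j = nth 0 x j]).
Proof.
move=> hS sx h1 h3 h4 hst.
pose I D := [/\ D 1 = n, D 3 = 1, D 4 = 20 + n, 20 <= D 6 &
   stores n x D /\ forall j, 20 <= j < minn n (D 6) -> D j = nth 0 x j].
apply: wp_seq_blk => //; [by rewrite /=; lia|by upd_simpl; lia|].
apply: (@wp_while S 6 1 _ I (fun D => n - D 6) 4); try lia.
- by upd_simpl; lia.
- split=> //; split; last by upd_simpl => j; lia.
  by move=> j hj; rewrite -hst //; upd_simpl.
- move=> D [d1 d3 d4 d6 [ds dj]]; rewrite d1 => hlt.
  apply: wp_blk => //; first by upd_simpl; lia.
  have E : D (D 4 + D 6) = nth 0 x (D 6) by rewrite d4 ds ?sx.
  split; last by upd_simpl; lia.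
  split; [by upd_simpl..|by upd_simpl; lia|split].
  + by move=> j hj; rewrite -ds //; upd_simpl.
  + move=> j; upd_simpl => hj; case: (eqVneq j (D 6)) => [->|ne].
      by upd_simpl.
    by upd_simpl; apply: dj; lia.
- move=> D [d1 d3 d4 d6 [ds dj]] hge; split=> // j hj; apply: dj; lia.
Qed.

(** Each register computes its own source address as [B + 19 - (19 - m)]; the sources lie at 20 or
    above and stay intact. *)
Lemma wp_copy_low S B R m : m <= 19 -> R 19 = B + 19 -> 20 <= B -> B + 19 < S ->
  wp S (copy_low_cmd m) R (3 * m) (fun R' =>
    (forall j, j < m -> R' j = R (B + j)) /\ (forall j, m <= j -> R' j = R j)).
Proof.
move=> + h19 hB hS; elim: m => [|m IH] hm; first by apply: wp_blk.
apply: (wp_seq_conseq (t2 := 3) (IH (ltnW hm))); last by lia.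
move=> D [hlo hhi].
have D19 : D 19 = B + 19 by rewrite hhi // ltnW.
have e : B + 19 - (19 - m) = B + m by lia.
apply: wp_blk => //; rewrite /= /upd /= !eqxx.
  by upd_simpl; rewrite D19 e; lia.
split=> j hj.
  upd_simpl; rewrite D19 e; upd_simpl.
  case: (eqVneq j m) => [->|ne]; first by rewrite hhi //; lia.
  by apply: hlo; lia.
by upd_simpl; apply: hhi; lia.
Qed.

Lemma wp_unrank S n k r : 3 * n + 40 < S -> 0 < n -> 0 < k ->
  0 < r <= size (unbordered_words n k) ->
  wp S unrank_cmd (init_regs r n k) (200 * (n ^ 4 * k)) (fun R' =>
    exists2 x, has_rank n k r x & forall i, i < n -> R' i = nth 0 x i).
Proof.
move=> hS n0 k0 hr.
have : [/\ init_regs r n k 0 = r, init_regs r n k 1 = n & init_regs r n k 2 = k] by [].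
move: (init_regs r n k) => Ri [i0 i1 i2].
pose t0 := n * (k * (70 * n ^ 3 + 4) + 7) + 2.
(* The 67 steps are 7 for initialisation, 2 for the address in register 19, 57 for the low registers
   and 1 for the last load. *)
have ht : t0 + (5 * n + 3) + 67 <= 200 * (n ^ 4 * k).
  have N0 : 0 < n ^ 3 by rewrite expn_gt0 n0.
  rewrite /t0 (expnS n 3); move: (n ^ 3) N0 => N N0.
  have hnk : n * k <= n * N * k by rewrite -mulnA leq_pmul2l // leq_pmull.
  have hn : n <= n * k by rewrite leq_pmulr.
  by move: hnk hn; rewrite !mulnDr; lia.
apply: wp_seq_blk => //; [by rewrite /=; lia|by upd_simpl; lia|].
set R0 := blk_run _ _.
apply: (@wp_seq_conseq _ _ _ _ t0 (5 * n + 3 + 60)).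
- apply: (@wp_search S n k r) => //.
  by rewrite /R0; split; [upd_simpl; rewrite ?i1..|split; upd_simpl; lia].
- move=> D [x sx [[d1 d2 d3 d4 _] d6 _ ds [_ drk d0]]].
  apply: (wp_seq_conseq (wp_copy_high hS sx d1 d3 d4 ds) (t2 := 60)) => //.
  move=> A [a4 as_ ahi].
  apply: wp_seq_blk => //; [by upd_simpl; lia|].
  set A1 := blk_run _ _.
  have A19 : A1 19 = 20 + n + 19 by rewrite /A1; upd_simpl; lia.
  have eA j : j != 19 -> A1 j = A j by move=> hj; rewrite /A1; upd_simpl.
  apply: (wp_seq_conseq (t2 := 1) (@wp_copy_low S (20 + n) A1 19 _ A19 _ _)) => //; try lia.
  move=> C [clo chi].
  have C19 : C 19 = 20 + n + 19 by rewrite chi.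
  apply: wp_blk => //; first by upd_simpl; lia.
  exists x; first by rewrite -drk; apply: has_rank_full_prefix.
  move=> i hi; upd_simpl; rewrite C19.
  have hx : A1 (20 + n + i) = nth 0 x i.
    by rewrite eA ?as_ ?sx //; lia.
  case: (ltngtP i 19) => hi19.
  + by upd_simpl; rewrite clo.
  + by upd_simpl; rewrite chi ?eA ?ahi //; lia.
  + by move: hx; rewrite hi19 => <-; apply: chi; lia.
- by rewrite /=; lia.
Qed.

(** * Space bound and conclusion *)

Lemma leq_space_used S acc : 2 < S -> all (gtn S) acc -> space_used acc <= S.
Proof.
move=> hS hacc; rewrite /space_used -[leqRHS](size_iota 0).
apply: uniq_leq_size; first exact: undup_uniq.
move=> j; rewrite mem_undup mem_iota /= !inE add0n.
by case/or4P=> [/eqP->|/eqP->|/eqP->|/(allP hacc)] //=; lia.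
Qed.

Theorem theorem12 :
  exists (p : program) (c : nat),
    forall n k r : nat, 1 <= n -> 2 <= k ->
      1 <= r <= size (unbordered_words n k) ->
      exists (R : regs) (acc : seq nat) (w : seq nat),
        run p (c * (n ^ 4 * k * trunc_log 2 k)) 0 (init_regs r n k) = Some (R, acc)
        /\ space_used acc <= c * n
        /\ has_rank n k r w
        /\ (forall i, i < n -> R i = nth 0 w i).
Proof.
exists (compile unrank_cmd 0), 201 => n k r n0 k2 hr.
(* The table ends at address [3 * n + 20]; the low copy always reads up to [n + 39], even when the
   word is shorter. Both lie below [S]. *)
pose S := 3 * n + 41.
have k0 : 0 < k by exact: ltnW.
have hlog : 0 < trunc_log 2 k by rewrite trunc_log_gt0.
have hpos : 0 < n ^ 4 * k by rewrite muln_gt0 expn_gt0 n0.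
have hS : 3 * n + 40 < S by rewrite /S; lia.
have H := wp_unrank hS n0 k0 hr.
(* The logarithm is at least 1, and raising 200 to 201 leaves room for the halting step. *)
have ht : 200 * (n ^ 4 * k) <= (201 * (n ^ 4 * k * trunc_log 2 k)).-1 by nia.
have [R [acc [h1 h2 [w h3 h4]]]] := wp_run (wp_conseq H ht (fun _ h => h)).
exists R, acc, w; split; [|split] => //.
- by rewrite prednK in h1 => //; nia.
- by apply: leq_trans (leq_space_used _ h2) _; rewrite /S; lia.
Qed.
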